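(* Let $E/\mathbb{Q}$ be an elliptic curve, let $\Delta>0$, and let $h\in\mathscr{H}$ satisfy $\operatorname{supp}\widehat h\subseteq[-\Delta,\Delta]$. Then the finite-place term $$\mathcal{P}_E(h)=-\frac1\pi\sum_{n\ge1}\frac{\Lambda_E(n)}{n}\,\widehat h\!\left(\frac{\log n}{2\pi}\right)$$ contains only prime powers $n$ satisfying $$n\le\exp(2\pi\Delta),$$ i.e. every term with $n>\exp(2\pi\Delta)$ vanishes, so the sum is finite; there is no omitted prime tail.
   Context: Fourier transform: $\widehat h(\xi)=\int_{\mathbb{R}}h(u)e^{-2\pi iu\xi}\,du$. $\mathscr{H}$ is the real vector space of even entire functions $h$ with $h(\overline z)=\overline{h(z)}$ and $\sup_{x\in\mathbb{R},|y|\le Y}(1+|x|)^A|h(x+iy)|<\infty$ for all $A,Y>0$. Write the Euler factor of the Hasse--Weil $L$-function $L(E,s)$ at each prime $p$ as $L_p(E,s)=\prod_{j=1}^{d_p}(1-\alpha_{p,j}p^{-s})^{-1}$ with $d_p\in\{0,1,2\}$ ($d_p=2$ at good primes). Define $\Lambda_E(p^m)=(\log p)\sum_{j=1}^{d_p}\alpha_{p,j}^m$ for $m\ge1$ and $\Lambda_E(n)=0$ if $n$ is not a prime power, so that $-\frac{L'}{L}(E,s)=\sum_{n\ge1}\Lambda_E(n)n^{-s}$ in the half-plane of absolute convergence. $\mathcal{P}_E(h)$ is the finite-place part of the explicit formula for $L(E,s)$. *)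

(* Defs.v *)
From HB Require Import structures.
From mathcomp Require Import all_boot all_order all_algebra.
From mathcomp Require Import all_classical all_reals all_analysis.
From mathcomp Require Import complex.
From mathcomp Require Import ring.
Set Implicit Arguments.
Unset Strict Implicit.
Unset Printing Implicit Defensive.
Import Order.TTheory GRing.Theory Num.Theory.
Import numFieldNormedType.Exports.
Local Open Scope classical_set_scope.
Local Open Scope ring_scope.
Local Open Scope complex_scope.

(** [y^2 + a1 x y + a3 y = x^3 + a2 x^2 + a4 x + a6] *)
Record weierstrass (K : Type) := Weierstrass {
  wa1 : K; wa2 : K; wa3 : K; wa4 : K; wa6 : K }.

Definition map_weierstrass (K L : Type) (f : K -> L) (W : weierstrass K) :=
  Weierstrass (f (wa1 W)) (f (wa2 W)) (f (wa3 W)) (f (wa4 W)) (f (wa6 W)).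

Section Weierstrass.
Variable K : comNzRingType.
Implicit Types (W : weierstrass K) (x y : K).

Definition wb2 W := wa1 W ^+ 2 + 4 * wa2 W.
Definition wb4 W := 2 * wa4 W + wa1 W * wa3 W.
Definition wb6 W := wa3 W ^+ 2 + 4 * wa6 W.
Definition wb8 W :=
  wa1 W ^+ 2 * wa6 W + 4 * wa2 W * wa6 W - wa1 W * wa3 W * wa4 W
  + wa2 W * wa3 W ^+ 2 - wa4 W ^+ 2.

Definition wdisc W :=
  - wb2 W ^+ 2 * wb8 W - 8 * wb4 W ^+ 3 - 27 * wb6 W ^+ 2
  + 9 * wb2 W * wb4 W * wb6 W.

Definition weq W x y :=
  y ^+ 2 + wa1 W * x * y + wa3 W * y
  - (x ^+ 3 + wa2 W * x ^+ 2 + wa4 W * x + wa6 W).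

(** [weq] and its two partial derivatives vanish at [(x, y)]. *)
Definition singular_pt W x y :=
  [&& weq W x y == 0,
      wa1 W * y - (3 * x ^+ 2 + 2 * wa2 W * x + wa4 W) == 0 &
      2 * y + wa1 W * x + wa3 W == 0].

(** The quadratic part of [weq] at a singular point [(x, y)] is
    [dy^2 + a1 dx dy - (3 x + a2) dx^2]; its roots [m = dy / dx] are the slopes
    of the tangent lines, which are distinct (over an algebraic closure) iff
    [tangent_disc] is nonzero. *)
Definition tangent_slope W x m :=
  m ^+ 2 + wa1 W * m - (3 * x + wa2 W) == 0.
Definition tangent_disc W x := wa1 W ^+ 2 + 4 * (3 * x + wa2 W).

Lemma tangent_coneE W x y s t : singular_pt W x y ->
  weq W (x + s) (y + t)
  = t ^+ 2 + wa1 W * s * t - (3 * x + wa2 W) * s ^+ 2 - s ^+ 3.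
Proof.
case: W => a1 a2 a3 a4 a6; rewrite /singular_pt /weq /=.
case/and3P => /eqP e0 /eqP e1 /eqP e2.
have -> : (y + t) ^+ 2 + a1 * (x + s) * (y + t) + a3 * (y + t)
  - ((x + s) ^+ 3 + a2 * (x + s) ^+ 2 + a4 * (x + s) + a6)
  = (y ^+ 2 + a1 * x * y + a3 * y - (x ^+ 3 + a2 * x ^+ 2 + a4 * x + a6))
  + s * (a1 * y - (3 * x ^+ 2 + 2 * a2 * x + a4))
  + t * (2 * y + a1 * x + a3)
  + (t ^+ 2 + a1 * s * t - (3 * x + a2) * s ^+ 2 - s ^+ 3) by ring.
by rewrite e0 e1 e2 !mulr0 !add0r.
Qed.

End Weierstrass.

(** The equation obtained from [W] by the substitution
    [x = u^2 x' + r], [y = u^3 y' + s u^2 x' + t]. *)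
Definition wchange (K : fieldType) (u r s t : K) (W : weierstrass K) :=
  let: Weierstrass a1 a2 a3 a4 a6 := W in
  Weierstrass
    ((a1 + 2 * s) / u)
    ((a2 - s * a1 + 3 * r - s ^+ 2) / u ^+ 2)
    ((a3 + r * a1 + 2 * t) / u ^+ 3)
    ((a4 - s * a3 + 2 * r * a2 - (t + r * s) * a1 + 3 * r ^+ 2 - 2 * s * t)
       / u ^+ 4)
    ((a6 + r * a4 + r ^+ 2 * a2 + r ^+ 3 - t * a3 - t ^+ 2 - r * t * a1)
       / u ^+ 6).

Lemma wchangeE (K : fieldType) (u r s t : K) (W : weierstrass K) (x y : K) :
  u != 0 ->
  weq W (u ^+ 2 * x + r) (u ^+ 3 * y + s * u ^+ 2 * x + t)
  = u ^+ 6 * weq (wchange u r s t W) x y.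
Proof. by case: W => a1 a2 a3 a4 a6 u0; rewrite /weq /=; field. Qed.

Lemma wdisc_change (K : fieldType) (u r s t : K) (W : weierstrass K) :
  u != 0 -> u ^+ 12 * wdisc (wchange u r s t W) = wdisc W.
Proof.
by case: W => a1 a2 a3 a4 a6 u0; rewrite /wdisc /wb2 /wb4 /wb6 /wb8 /=; field.
Qed.

(** An elliptic curve over [Q], given by a nonsingular Weierstrass equation. *)
Record ellipticQ := EllipticQ {
  ell_eq :> weierstrass rat;
  ell_smooth : wdisc ell_eq != 0 }.

(** For [p] prime, [p_integral p x] says that [x] lies in the localization of
    [Z] at [p]. *)
Definition p_integral (p : nat) (x : rat) : bool := coprime p `|denq x|%N.

Definition w_integral (p : nat) (W : weierstrass rat) : bool :=
  [&& p_integral p (wa1 W), p_integral p (wa2 W), p_integral p (wa3 W),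
      p_integral p (wa4 W) & p_integral p (wa6 W)].

Definition is_model (p : nat) (W W' : weierstrass rat) : Prop :=
  (exists u r s t : rat, u != 0 /\ W' = wchange u r s t W) /\ w_integral p W'.

(** For a [p]-integral equation the denominator of the discriminant is prime
    to [p], so this is its [p]-adic valuation. *)
Definition disc_val (p : nat) (W : weierstrass rat) : nat :=
  logn p `|numq (wdisc W)|%N.

Definition is_minimal_model (p : nat) (W W' : weierstrass rat) : Prop :=
  is_model p W W' /\
  forall W'', is_model p W W'' -> (disc_val p W' <= disc_val p W'')%N.

Lemma p_integral_den (p : nat) (x : rat) (d : int) (n : nat) :
  p_integral p (x * (denq x * d)%:~R ^+ n.+1).
Proof.
have -> : x * (denq x * d)%:~R ^+ n.+1
    = (numq x * d * (denq x * d) ^+ n)%:~R.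
  by rewrite !rmorphM rmorphXn rmorphM /= exprS numqE !mulrA.
by rewrite /p_integral denq_int coprimen1.
Qed.

Lemma is_model_ex (p : nat) (W : weierstrass rat) : exists W', is_model p W W'.
Proof.
case: W => a1 a2 a3 a4 a6.
pose D : int := denq a1 * denq a2 * denq a3 * denq a4 * denq a6.
have D0 : D%:~R != 0 :> rat by rewrite intr_eq0 !mulf_neq0 ?denq_neq0.
exists (wchange (D%:~R)^-1 0 0 0 (Weierstrass a1 a2 a3 a4 a6)).
split; first by exists (D%:~R)^-1, 0, 0, 0; rewrite invr_eq0.
have int_D (x : rat) (d : int) (n : nat) : D = denq x * d ->
    p_integral p (x * D%:~R ^+ n.+1).
  by move=> ->; exact: p_integral_den.
have -> : wchange (D%:~R)^-1 0 0 0 (Weierstrass a1 a2 a3 a4 a6)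
    = Weierstrass (a1 * D%:~R ^+ 1) (a2 * D%:~R ^+ 2) (a3 * D%:~R ^+ 3)
                  (a4 * D%:~R ^+ 4) (a6 * D%:~R ^+ 6).
  by rewrite /wchange; move: (D%:~R) D0 => d d0; congr Weierstrass; field.
apply/and5P; split.
- by apply: (@int_D _ (denq a2 * denq a3 * denq a4 * denq a6)); rewrite /D; ring.
- by apply: (@int_D _ (denq a1 * denq a3 * denq a4 * denq a6)); rewrite /D; ring.
- by apply: (@int_D _ (denq a1 * denq a2 * denq a4 * denq a6)); rewrite /D; ring.
- by apply: (@int_D _ (denq a1 * denq a2 * denq a3 * denq a6)); rewrite /D; ring.
- by apply: (@int_D _ (denq a1 * denq a2 * denq a3 * denq a4)); rewrite /D; ring.
Qed.

Lemma is_minimal_model_ex (p : nat) (W : weierstrass rat) :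
  exists W', is_minimal_model p W W'.
Proof.
have [W0 W0m] := is_model_ex p W.
have ex : exists n, `[< exists W', is_model p W W' /\ disc_val p W' = n >].
  by exists (disc_val p W0); apply/asboolP; exists W0.
case: (ex_minnP ex) => n /asboolP[W' [W'm <-]] nmin.
exists W'; split=> // W'' W''m; apply: nmin.
by apply/asboolP; exists W''.
Qed.

(** Any two minimal models at a prime [p] have isomorphic reductions, so the
    Euler factor below does not depend on this choice. *)
Definition minimal_model (p : nat) (W : weierstrass rat) : weierstrass rat :=
  projT1 (cid (is_minimal_model_ex p W)).

Lemma minimal_modelP (p : nat) (W : weierstrass rat) :
  is_minimal_model p W (minimal_model p W).
Proof. exact: projT2 (cid (is_minimal_model_ex p W)). Qed.

(** On [p]-integral rationals [ratr] is the reduction map to ['F_p]. *)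
Definition w_reduction (p : nat) (W : weierstrass rat) : weierstrass 'F_p :=
  map_weierstrass (fun x : rat => ratr x : 'F_p) (minimal_model p W).

Section Reduction.
Variables (F : finFieldType) (W : weierstrass F).

Definition good_reduction : bool := wdisc W != 0.

(** The slopes at the node are in [F]. *)
Definition split_mult : bool :=
  [exists x : F, exists y : F, exists m1 : F, exists m2 : F,
    [&& singular_pt W x y, m1 != m2, tangent_slope W x m1
      & tangent_slope W x m2]].

Definition has_node : bool :=
  [exists x : F, exists y : F, singular_pt W x y && (tangent_disc W x != 0)].

(** Affine points, and the point at infinity. *)
Definition card_points : nat := #|[set P : F * F | weq W P.1 P.2 == 0]%SET|.+1.

Definition frob_trace : int := #|F|%:Z + 1 - card_points%:Z.

(** The polynomial [P] such that the Euler factor is [1 / P(#|F|^-s)].  Since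
    [F] is perfect, the singular point of a singular equation is rational. *)
Definition local_poly : {poly int} :=
  if good_reduction then 1 - frob_trace%:P * 'X + (#|F|%:Z)%:P * 'X^2
  else if split_mult then 1 - 'X
  else if has_node then 1 + 'X
  else 1.

Lemma local_poly0 : local_poly.[0] = 1.
Proof.
rewrite /local_poly; case: ifP => _; first by rewrite !hornerE /=; ring.
by case: ifP => _; [|case: ifP => _]; rewrite !hornerE /= ?subr0 ?addr0.
Qed.

End Reduction.

(** [L_p(E, s) = (euler_poly E p).[p^-s]^-1] *)
Definition euler_poly (E : ellipticQ) (p : nat) : {poly int} :=
  local_poly (w_reduction p E).

Section Coefficients.
Variable R : realType.
Implicit Types (E : ellipticQ) (p n : nat).

Lemma euler_roots_ex E p : exists s : seq R[i],
  0 \notin s /\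
  map_poly intr (euler_poly E p) = \prod_(a <- s) (1 - a%:P * 'X).
Proof.
set P := map_poly _ _.
have P0 : P.[0] = 1.
  by rewrite /P -(rmorph0 (intmul (1 : R[i]))) horner_map /= local_poly0.
have [r Pr] := closed_field_poly_normal P.
have r0 : 0 \notin r.
  apply/negP => r0; move/eqP: P0; rewrite Pr hornerZ.
  have /rootP -> : root (\prod_(z <- r) ('X - z%:P)) 0.
    by rewrite root_prod_XsubC.
  by rewrite mulr0 eq_sym oner_eq0.
have nz z : z \in r -> z != 0 by move=> zr; apply: contraNneq r0 => <-.
have prE : \prod_(z <- r) ('X - z%:P)
    = (\prod_(z <- r) (- z)) *: \prod_(z <- r) (1 - (z^-1)%:P * 'X).
  rewrite -mul_polyC rmorph_prod -big_split /=.
  rewrite !big_seq; apply: eq_bigr => z /nz z0.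
  rewrite mulrBr mulr1 mulrA -polyCM mulNr mulfV //.
  by rewrite !polyCN polyC1 mulN1r opprK addrC.
exists [seq z^-1 | z <- r]; split.
  by apply/mapP => -[z /nz z0 /esym /eqP]; rewrite invr_eq0 (negPf z0).
rewrite big_map; set Q := \prod_(_ <- _) (1 - _) in prE *.
have Q0 : Q.[0] = 1.
  by rewrite /Q horner_prod big1 // => z _; rewrite hornerD hornerN hornerMX hornerC mulr0 subr0.
move: P0; rewrite Pr prE scalerA hornerZ Q0 mulr1 => ->.
by rewrite scale1r.
Qed.

(** [alpha_(p,1), ..., alpha_(p,d_p)]; since they are nonzero, [d_p] is the
    degree of [euler_poly E p]. *)
Definition euler_roots E p : seq R[i] := projT1 (cid (euler_roots_ex E p)).

Lemma euler_rootsP E p : 0 \notin euler_roots E p /\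
  map_poly intr (euler_poly E p) = \prod_(a <- euler_roots E p) (1 - a%:P * 'X).
Proof. exact: projT2 (cid (euler_roots_ex E p)). Qed.

Definition LambdaE E n : R[i] :=
  if primes n is [:: p] then
    (ln p%:R : R)%:C * \sum_(a <- euler_roots E p) a ^+ logn p n
  else 0.

Lemma LambdaE_pfactor E p m : prime p -> (0 < m)%N ->
  LambdaE E (p ^ m) = (ln p%:R : R)%:C * \sum_(a <- euler_roots E p) a ^+ m.
Proof.
by move=> pp m0; rewrite /LambdaE primesX // primes_prime // pfactorK.
Qed.

Lemma LambdaE_eq0 E n :
  (forall p m, prime p -> (0 < m)%N -> n <> (p ^ m)%N) -> LambdaE E n = 0.
Proof.
move=> npp; rewrite /LambdaE.
case prn: (primes n) => [//|p [|//]].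
have : p \in primes n by rewrite prn inE.
rewrite mem_primes => /and3P[pp n0 pn].
case: (npp p (logn p n)) => //; first by rewrite logn_gt0 prn inE.
by rewrite {1}(prod_prime_decomp n0) prime_decompE prn /= big_seq1.
Qed.

(** [e^(-2 pi i u xi)] *)
Definition fourier_char (u xi : R) : R[i] :=
  cos (2 * pi * u * xi) +i* - sin (2 * pi * u * xi).

Definition cintegral (f : R -> R[i]) : R[i] :=
  (\int[@lebesgue_measure R]_(u in setT) complex.Re (f u))
  +i* (\int[@lebesgue_measure R]_(u in setT) complex.Im (f u)).

(** The Fourier transform of the restriction of [h] to the real line. *)
Definition fourier (h : R[i] -> R[i]) (xi : R) : R[i] :=
  cintegral (fun u : R => h u%:C * fourier_char u xi).

Definition closed_support (g : R -> R[i]) : set R := closure [set x | g x != 0].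

Definition entire (h : R[i] -> R[i]) : Prop :=
  forall z : R[i], derivable (h : R[i]^o -> R[i]^o) z 1.

Definition test_space : set (R[i] -> R[i]) := [set h |
  [/\ entire h,
      (forall z, h (- z) = h z),
      (forall z, h z^* = (h z)^*) &
      forall A Y : R, 0 < A -> 0 < Y -> exists M : R,
        forall x y : R, `|y| <= Y ->
          (1 + `|x|) `^ A * Normc.normc (h (x +i* y)) <= M]].

Definition finite_place_summand E (h : R[i] -> R[i]) n : R[i] :=
  LambdaE E n / n%:R * fourier h (ln n%:R / (2 * pi)).

Definition finite_place_partial_sum E (h : R[i] -> R[i]) (N : nat) : R[i]^o :=
  \sum_(1 <= n < N) finite_place_summand E h n.

Definition finite_place_term E (h : R[i] -> R[i]) : R[i] :=
  - (pi^-1)%:C * limn (finite_place_partial_sum E h).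

End Coefficients.

(* Main.v *)
Require Import Defs.
From mathcomp Require Import all_boot all_order all_algebra.
From mathcomp Require Import all_classical all_reals all_analysis.
From mathcomp Require Import complex.
Import Order.TTheory GRing.Theory Num.Theory.
Import numFieldNormedType.Exports.
Local Open Scope classical_set_scope.
Local Open Scope ring_scope.
Local Open Scope complex_scope.

(** The support condition makes [fourier h] vanish at every point above [Delta],
    and the [n]-th term samples it at [ln n / (2 pi)], which exceeds [Delta] as
    soon as [n > exp (2 pi Delta)] ([finite_place_summand_eq0]).  Only the
    indices up to the integer part of [exp (2 pi Delta)] can therefore
    contribute, so the sequence of partial sums is eventually constant and its
    limit is the finite sum ([finite_place_partial_sum_cvg]).  That the
    contributing indices are prime powers comes from the factor [LambdaE] of the
    [n]-th term ([LambdaE_neq0]). *)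

Lemma closed_support_notin (R : realType) (g : R -> R[i]) (x : R) :
  ~ closed_support g x -> g x = 0.
Proof.
move=> gx; apply/eqP; apply: contra_notT gx => gx0.
exact: subset_closure.
Qed.

Lemma LambdaE_neq0 (R : realType) (E : ellipticQ) (n : nat) :
  LambdaE R E n != 0 ->
  exists p m : nat, [/\ prime p, (0 < m)%N & n = (p ^ m)%N].
Proof.
apply: contraNP => npp; apply/eqP/LambdaE_eq0 => p m pp m0 nE.
by apply: npp; exists p, m.
Qed.

Lemma lt_ln_div2pi (R : realType) (Delta x : R) :
  expR (2 * pi * Delta) < x -> Delta < ln x / (2 * pi).
Proof.
move=> ltx; have x0 : 0 < x by exact: lt_trans (expR_gt0 _) ltx.
rewrite ltr_pdivlMr ?mulr_gt0 ?pi_gt0 //.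
by rewrite mulrC -ltr_expR lnK.
Qed.

(** The sampling point [ln n / (2 pi)] lies to the right of the support. *)
Lemma finite_place_summand_eq0 (R : realType) (E : ellipticQ) (Delta : R)
    (h : R[i] -> R[i])
    (supp_h : closed_support (fourier h) `<=` [set x | - Delta <= x <= Delta])
    (n : nat) :
  expR (2 * pi * Delta) < n%:R -> finite_place_summand E h n = 0.
Proof.
move=> /lt_ln_div2pi ltn; rewrite /finite_place_summand.
rewrite closed_support_notin ?mulr0 // => /supp_h /= /andP[_].
by rewrite leNgt ltn.
Qed.

Lemma finite_place_summand_ge_cutoff (R : realType) (E : ellipticQ) (Delta : R)
    (h : R[i] -> R[i])
    (supp_h : closed_support (fourier h) `<=` [set x | - Delta <= x <= Delta])
    (n : nat) :
  ((Num.truncn (expR (2 * pi * Delta))).+1 <= n)%N ->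
  finite_place_summand E h n = 0.
Proof.
move=> cn; apply: (finite_place_summand_eq0 _ E _ _ supp_h).
by apply: lt_le_trans (truncnS_gt _) _; rewrite ler_nat.
Qed.

(** Once past the cutoff the partial sums no longer change.  The partial sum of
    index [N] runs over [n < N], and the largest integer not above
    [exp (2 pi Delta)] must be kept, hence the successor. *)
Lemma finite_place_partial_sum_cvg (R : realType) (E : ellipticQ) (Delta : R)
    (h : R[i] -> R[i])
    (supp_h : closed_support (fourier h) `<=` [set x | - Delta <= x <= Delta]) :
  finite_place_partial_sum E h @ \oo -->
    finite_place_partial_sum E h (Num.truncn (expR (2 * pi * Delta))).+1.
Proof.
set cutoff := (Num.truncn _).+1.
apply: cvg_near_cst; exists cutoff => // N /= cN.
rewrite /finite_place_partial_sum (big_cat_nat (n := cutoff)) //=.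
rewrite [X in _ + X]big_nat_cond [X in _ + X]big1 ?addr0 //.
move=> n /andP[/andP[cn _] _].
exact: (finite_place_summand_ge_cutoff _ E _ _ supp_h).
Qed.

Theorem theorem10p3 (R : realType) (E : ellipticQ) (Delta : R)
    (h : R[i] -> R[i]) (Delta_gt0 : 0 < Delta) (hH : test_space h)
    (supp_h : closed_support (fourier h) `<=` [set x | - Delta <= x <= Delta]) :
  [/\ forall n : nat, (1 <= n)%N -> finite_place_summand E h n != 0 ->
        (exists p m : nat, [/\ prime p, (0 < m)%N & n = (p ^ m)%N]) /\
        n%:R <= expR (2 * pi * Delta),
      forall n : nat, expR (2 * pi * Delta) < n%:R ->
        finite_place_summand E h n = 0,
      finite_set [set n : nat | (1 <= n)%N /\ finite_place_summand E h n != 0],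
      cvgn (finite_place_partial_sum E h) &
      finite_place_term E h =
        - (pi^-1)%:C *
        \sum_(1 <= n < (Num.truncn (expR (2 * pi * Delta))).+1)
          finite_place_summand E h n].
Proof.
have vanish := finite_place_summand_eq0 _ E _ _ supp_h.
have cv := finite_place_partial_sum_cvg _ E _ _ supp_h.
split.
- move=> n _ n0; split; last by rewrite leNgt; apply: contraNN n0 => /vanish ->.
  apply: (LambdaE_neq0 R E); apply: contraNneq n0 => L0.
  by rewrite /finite_place_summand L0 !mul0r.
- exact: vanish.
- apply: sub_finite_set (finite_II (Num.truncn (expR (2 * pi * Delta))).+1).
  move=> n /= [_]; rewrite ltnNge; apply: contraNN => cn.
  by rewrite (finite_place_summand_ge_cutoff _ E _ _ supp_h).
- by apply/cvg_ex; eexists; exact: cv.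
- by rewrite /finite_place_term (cvg_lim _ cv) //; exact: norm_hausdorff.
Qed.
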